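(* Let $f\in C^1_b(\mathbb{R})$ and let $(u,m)$ be a classical solution of the MFG system. Let $K=K(\|f\|_{L^\infty},d)>0$ be the constant of Proposition 2.4, i.e. a constant depending only on $\|f\|_{L^\infty}$ and $d$ such that every classical solution $(\tilde u,\tilde m)$ of the MFG system satisfies $\|D\tilde u\|_{L^\infty}\le K$, and set $M:=2\|f\|_{L^\infty}+K^2/2$ and $\Lambda:=\max\{2M,\ K^2/2+\|m_0\|_{L^\infty}\|f'\|_{L^\infty}\}$. Then $(u,m)$ is stable provided that one of the following holds: (i) $f'\ge 0$; (ii) $\lambda>\Lambda$.
   Context: $\mathbb{T}^d$ is the flat torus, $\lambda>0$, $\alpha\in(0,1)$, $m_0\in C^{0,\alpha}(\mathbb{T}^d)$ a probability density. $C^1_b(\mathbb{R})$: $C^1$ functions with $f,f'$ bounded. The MFG system is $-\Delta u + \tfrac12|Du|^2 + \lambda u = f(m)$, $-\Delta m - \operatorname{div}(m Du) + \lambda m = \lambda m_0$ in $\mathbb{T}^d$ (classical solution: $C^2$ pair satisfying it pointwise). A classical solution $(u,m)$ is stable if $(v,\rho)=(0,0)$ is the unique classical solution of $-\Delta v + Du\cdot Dv + \lambda v = f'(m)\rho$, $-\Delta\rho - \operatorname{div}(\rho Du) + \lambda\rho = \operatorname{div}(m Dv)$ in $\mathbb{T}^d$. The constant $K$ does not depend on $\lambda$. *)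

(* Defs.v *)
(* R : realType, T^d modelled as Z^d-periodic
   functions on 'rV[R]_d. *)
From HB Require Import structures.
From mathcomp Require Import all_boot all_order all_algebra.
From mathcomp Require Import all_classical all_reals all_analysis.
Set Implicit Arguments. Unset Strict Implicit. Unset Printing Implicit Defensive.
Import Order.TTheory GRing.Theory Num.Theory.
Import numFieldNormedType.Exports.
Local Open Scope classical_set_scope.
Local Open Scope ring_scope.

Section MFG.
Variables (R : realType) (d : nat).

Definition evec (i : 'I_d) : 'rV[R]_d := \row_j (i == j)%:R.

Definition pd (i : 'I_d) (g : 'rV[R]_d -> R) : 'rV[R]_d -> R :=
  fun x => 'D_(evec i) g x.

(* g is Z^d-periodic, i.e. a function on the flat torus T^d = R^d / Z^d *)
Definition periodic (g : 'rV[R]_d -> R) : Prop :=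
  forall x i, g (x + evec i) = g x.

Definition isC2 (g : 'rV[R]_d -> R) : Prop :=
  continuous g /\
  (forall i x, derivable g x (evec i)) /\
  (forall i, continuous (pd i g)) /\
  (forall i j x, derivable (pd i g) x (evec j)) /\
  (forall i j, continuous (pd j (pd i g))).

Definition lap (g : 'rV[R]_d -> R) (x : 'rV[R]_d) : R :=
  \sum_(i < d) pd i (pd i g) x.

Definition gdot (g h : 'rV[R]_d -> R) (x : 'rV[R]_d) : R :=
  \sum_(i < d) pd i g x * pd i h x.

Definition grad_norm (g : 'rV[R]_d -> R) (x : 'rV[R]_d) : R :=
  Num.sqrt (gdot g g x).

Definition divmul (a b : 'rV[R]_d -> R) (x : 'rV[R]_d) : R :=
  \sum_(i < d) pd i (fun y => a y * pd i b y) x.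

Definition supnorm (T : Type) (g : T -> R) : R := sup [set `|g x| | x in [set: T]].

Definition C1b (f : R -> R) : Prop :=
  (forall s, derivable f s 1) /\ continuous ((derive1 f)) /\
  (exists C, forall s, `|f s| <= C) /\ (exists C, forall s, `|(derive1 f) s| <= C).

Fixpoint iter_int (n : nat) (G : (nat -> R) -> R) : R :=
  match n with
  | 0 => G (fun _ => 0)
  | n'.+1 => (\int[lebesgue_measure]_(t in `[0, 1]) 
               iter_int n' (fun y => G (fun k => if k == n' then t else y k)))%R
  end.

(* integral over the unit cube (fundamental domain of T^d) *)
Definition cube_int (g : 'rV[R]_d -> R) : R :=
  iter_int d (fun y => g (\row_i y (nat_of_ord i))).

Definition holder_prob_density (alpha : R) (m0 : 'rV[R]_d -> R) : Prop :=
  periodic m0 /\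
  (exists C, forall x y, `|m0 x - m0 y| <= C * (`|x - y| `^ alpha)) /\
  (forall x, 0 <= m0 x) /\ cube_int m0 = 1.

Definition MFG_solution (f : R -> R) (lambda : R) (m0 : 'rV[R]_d -> R)
  (u m : 'rV[R]_d -> R) : Prop :=
  periodic u /\ periodic m /\ isC2 u /\ isC2 m /\
  (forall x, - lap u x + (gdot u u x) / 2 + lambda * u x = f (m x)) /\
  (forall x, - lap m x - divmul m u x + lambda * m x = lambda * m0 x).

Definition lin_solution (f : R -> R) (lambda : R) (u m v rho : 'rV[R]_d -> R)
  : Prop :=
  periodic v /\ periodic rho /\ isC2 v /\ isC2 rho /\
  (forall x, - lap v x + gdot u v x + lambda * v x = (derive1 f) (m x) * rho x) /\
  (forall x, - lap rho x - divmul rho u x + lambda * rho x = divmul m v x).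

Definition stable (f : R -> R) (lambda : R) (u m : 'rV[R]_d -> R) : Prop :=
  forall v rho, lin_solution f lambda u m v rho -> v = (fun _ => 0) /\ rho = (fun _ => 0).

End MFG.

(* Main.v *)
Require Import Defs.
From HB Require Import structures.
From mathcomp Require Import all_boot all_order all_algebra.
From mathcomp Require Import all_classical all_reals all_analysis.
From mathcomp Require Import ring lra.
Import Order.TTheory GRing.Theory Num.Theory.
Import numFieldNormedType.Exports.
Local Open Scope classical_set_scope.
Local Open Scope ring_scope.

(* Idea. Testing both linearized equations against suitable combinations of
   [v] and [rho] writes a nonnegative function as a divergence plus [eps], so
   it vanishes. In case (i), pairing the equations crosswise gives
   [f'(m) rho^2 + m |Dv|^2 = div(...)], whence both terms vanish and [v], [rho]
   solve decoupled homogeneous equations. In case (ii), the maximum principle gives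
   [Delta u <= M] and [m <= 2 |m0|]; with [L = lambda - K^2/2] and [mu = |m0|],
   adding [4 mu^2] times the first equation tested with [v] to the second one
   tested with [rho] gives [(L - mu^2 |f'|^2 / L) rho^2 <= div(...)].
   No integral over the torus is needed: averages over fine grids play its role. *)

(** * Calculus along lines and uniform control of small shifts *)

Lemma is_derive_line (R : realType) (V : normedModType R) (g : V -> R)
  (x v : V) (t dg : R) :
  is_derive (t *: v + x) v g dg -> is_derive t 1 (fun s : R => g (s *: v + x)) dg.
Proof.
move=> [dgx dgE].
have E : (fun h : R => h^-1 *: (((fun s : R => g (s *: v + x)) \o shift t) (h *: 1)
    - g (t *: v + x))) =
   (fun h : R => h^-1 *: ((g \o shift (t *: v + x)) (h *: v) - g (t *: v + x))).
  apply/funext => h /=; rewrite [h *: 1]mulr1 scalerDl.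
  by rewrite addrA.
split; first by rewrite /derivable E.
by rewrite /derive E.
Qed.

Lemma directional_MVT (R : realType) (V : normedModType R) (g dg : V -> R)
    (x v : V) (t : R) :
  0 < t -> (forall y, is_derive y v g (dg y)) ->
  exists2 s, 0 < s < t & g (t *: v + x) - g x = dg (s *: v + x) * t.
Proof.
move=> t0 dgE.
have D (s : R) : is_derive s 1 (fun s : R => g (s *: v + x)) (dg (s *: v + x)).
  exact: is_derive_line.
have [|s + E] := @MVT R (fun s : R => g (s *: v + x)) (fun s => dg (s *: v + x))
  0 t t0 (fun s _ => D s).
  apply: continuous_subspaceT => s.
  exact/differentiable_continuous/derivable1_diffP/(@ex_derive _ _ _ _ _ _ _ (D s)).
rewrite in_itv /= => st; exists s => //.
by move: E; rewrite subr0 scale0r add0r.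
Qed.

(** Each map [(x, t) |-> h i (t *: e i + x) - h i x] is jointly continuous and vanishes at [t = 0].
    Compactness of [B] makes the neighbourhood of [t = 0] uniform in [x], and finiteness of ['I_d]
    makes it uniform in [i]. *)
Lemma uniform_small_shift (R : realType) (V : normedModType R) (d : nat) (e : 'I_d -> V)
    (h : 'I_d -> V -> R) (B : set V) (delta : R) :
  compact B -> (forall i, continuous (h i)) -> 0 < delta ->
  exists2 eta, 0 < eta & forall i t x, B x -> `|t| < eta ->
    `|h i (t *: e i + x) - h i x| < delta.
Proof.
move=> cB ch d0.
pose P (t : R) (x : V) := forall i, `|h i (t *: e i + x) - h i x| < delta.
have : \forall t \near (0 : R), B `<=` P t.
  move/compact_near_coveringP : cB => cov; refine (cov R (nbhs (0 : R)) P _ _) => x Bx.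
  apply: (@filter_forall _ _ (fun i (z : V * R) =>
    `|h i (z.2 *: e i + z.1) - h i z.1| < delta)
    (filter_prod (nbhs x) (nbhs (0 : R)))) => i.
  have C : (fun z : V * R => h i (z.2 *: e i + z.1) - h i z.1) z @[z --> (x, 0 : R)] -->
     h i (0 *: e i + x) - h i x.
    apply: cvgB.
      apply: continuous_cvg; first exact: ch.
      apply: cvgD; last exact: cvg_fst.
      by apply: cvgZr_tmp; exact: cvg_snd.
    by apply: continuous_cvg; [exact: ch|exact: cvg_fst].
  rewrite scale0r add0r subrr in C.
  move/cvgrPdist_lt : C => /(_ _ d0).
  by apply: filterS => z; rewrite sub0r normrN.
move=> /nbhs_ballP [eta /= eta0 H]; exists eta => // i t x Bx teta.
by apply: (H t _ x Bx i); rewrite /ball/= sub0r normrN.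
Qed.

(** * Sums of periodic functions over fine grids *)

Section GridAverage.
Variables (R : realType) (d : nat).
Implicit Types (g : 'rV[R]_d -> R) (x : 'rV[R]_d).

(** As [k] varies, these points represent once each the classes modulo Z^d of the translated lattice
    [x] + (1/N) Z^d. *)
Definition grid x (N : nat) (k : {ffun 'I_d -> 'I_N}) : 'rV[R]_d :=
  x + \row_i ((k i)%:R / N%:R).

(** A step of 1/N in direction [i] permutes the grid modulo Z^d: it is the cyclic successor [ordS]
    on the [i]-th index. *)
Lemma sum_grid_shift g x (N : nat) (i : 'I_d) : (0 < N)%N -> Defs.periodic g ->
  \sum_k g (N%:R^-1 *: evec R i + grid x N k) = \sum_k g (grid x N k).
Proof.
move=> N0 gper.
pose h (k : {ffun 'I_d -> 'I_N}) :=
  [ffun j => if j == i then ordS (k j) else k j].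
have hinj : injective h.
  move=> k l /ffunP hkl; apply/ffunP => j; move: (hkl j); rewrite !ffunE.
  by case: eqP => // _ /ordS_inj.
rewrite [RHS](reindex_inj hinj); apply: eq_bigr => k _.
have N0R : N%:R != 0 :> R by rewrite pnatr_eq0 -lt0n.
have [kN|kN] := ltnP (k i).+1 N.
  congr (g _); apply/rowP => j; rewrite !mxE ffunE eq_sym.
  case: eqP => [->|_]; last by rewrite mulr0 add0r.
  by rewrite /= modn_small// -natr1; field.
(* At the last index the successor wraps around to 0, and the two points differ by the period
   [evec R i]. *)
have kE : (k i).+1 = N by apply/eqP; rewrite eqn_leq kN ltn_ord.
rewrite -[RHS](gper _ i); congr (g _); apply/rowP => j; rewrite !mxE ffunE eq_sym.
case: eqP => [->|_]; last by rewrite mulr0 add0r addr0.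
have -> : (k i)%:R = N%:R - 1 :> R by rewrite -[X in X%:R - 1]kE -natr1 addrK.
by rewrite /= kE modnn; field.
Qed.

(** By the mean value theorem [dg] at a grid point is within [delta] of N times the forward
    difference of [g]. By shift invariance these differences sum to zero, leaving only the errors at
    the N^d points. *)
Lemma sum_grid_deriv_le g (dg : 'rV[R]_d -> R) x (N : nat) (i : 'I_d) (delta : R) :
  (0 < N)%N -> Defs.periodic g ->
  (forall y, is_derive y (evec R i) g (dg y)) ->
  (forall t k, 0 < t < N%:R^-1 ->
    `|dg (t *: evec R i + grid x N k) - dg (grid x N k)| <= delta) ->
  \sum_k dg (grid x N k) <= (N ^ d)%:R * delta.
Proof.
move=> N0 gper gdg small.
have N0R : 0 < N%:R :> R by rewrite ltr0n.
have V0 : 0 < N%:R^-1 :> R by rewrite invr_gt0.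
have le1 k : dg (grid x N k) <=
    N%:R * (g (N%:R^-1 *: evec R i + grid x N k) - g (grid x N k)) + delta.
  have [s sN E] := directional_MVT _ _ _ _ (grid x N k) _ _ V0 gdg.
  rewrite E mulrC mulfVK ?gt_eqF//.
  have := small s k sN; rewrite distrC ler_distl => /andP[_]; lra.
apply: (@le_trans _ _ (\sum_k
    (N%:R * (g (N%:R^-1 *: evec R i + grid x N k) - g (grid x N k)) + delta))).
  by apply: ler_sum => k _; exact: le1.
rewrite big_split/= -mulr_sumr sumrB sum_grid_shift// subrr mulr0 add0r.
by rewrite sumr_const card_ffun !card_ord mulr_natl.
Qed.

(** The n^d points whose indices are all below [n] lie in the subcube of side 1/M at [x], where [g]
    is at least [c]; the other terms are nonnegative. *)
Lemma sum_grid_ge g x (M n : nat) (c : R) :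
  (0 < M)%N -> (0 < n)%N -> (forall y, 0 <= g y) ->
  (forall y : 'rV[R]_d, (forall i, 0 <= y 0 i < M%:R^-1) -> c <= g (x + y)) ->
  (n ^ d)%:R * c <= \sum_k g (grid x (M * n) k).
Proof.
move=> M0 n0 g0 gc.
have nMn : (n <= M * n)%N by rewrite leq_pmull.
pose w (k : {ffun 'I_d -> 'I_n}) : {ffun 'I_d -> 'I_(M * n)} :=
  [ffun i => widen_ord nMn (k i)].
have winj : injective w.
  move=> k l /ffunP kl; apply/ffunP => i; apply/val_inj.
  by have /(congr1 val) := kl i; rewrite !ffunE.
rewrite (bigID [in w @: [set: _]]%SET)/=.
rewrite big_imset/=; last by move=> k l _ _; exact: winj.
rewrite -[leLHS]addr0; apply: lerD; last by apply: sumr_ge0.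
have -> : (n ^ d)%:R * c = \sum_(k in [set: {ffun 'I_d -> 'I_n}]%SET) c.
  by rewrite sumr_const cardsT card_ffun !card_ord mulr_natl.
apply: ler_sum => k _; apply: gc => i; rewrite mxE ffunE /=.
rewrite divr_ge0//= natrM invfM mulrCA gtr_pMr ?invr_gt0 ?ltr0n//.
by rewrite ltr_pdivrMr ?ltr0n// mul1r ltr_nat.
Qed.

End GridAverage.

(** * Vanishing of nonnegative functions dominated by divergences *)

Lemma exists_inv_lt (R : realType) (r : R) : 0 < r -> exists2 n : nat, (0 < n)%N & n%:R^-1 < r.
Proof.
move=> r0; exists (Num.bound r^-1).+1 => //.
rewrite invf_plt ?posrE ?ltr0n//.
apply: (lt_le_trans (archi_boundP _)); first by rewrite invr_ge0 ltW.
by rewrite ler_nat.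
Qed.

Lemma pos_near_cube (R : realType) (d : nat) (g : 'rV[R]_d -> R) (x : 'rV[R]_d) :
  continuous g -> 0 < g x ->
  exists2 M : nat, (0 < M)%N &
    forall y : 'rV[R]_d, (forall i, 0 <= y 0 i < M%:R^-1) -> g x / 2 <= g (x + y).
Proof.
move=> gc gx0; have gx2 : 0 < g x / 2 by rewrite divr_gt0.
have /cvgrPdist_lt /(_ _ gx2) /nbhs_ballP [r /= r0 H] := gc x.
have [M M0 Mr] := exists_inv_lt _ _ r0; exists M => // y yM.
have := H (x + y); rewrite ltr_distl => /(_ _)/andP[|_]; last by lra.
split=> // i j; rewrite /ball /= !mxE !ord1 opprD addNKr normrN.
have /andP[y0 yM'] := yM j.
by rewrite ger0_norm// (lt_trans yM').
Qed.

(* Averages over the grids [x + Z^d/N] annihilate divergences up to o(1), since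
   difference quotients of periodic functions sum to zero on them: they replace
   the integral over the torus. *)
Lemma nonneg_le_div_eq0 (R : realType) (d : nat) (g : 'rV[R]_d -> R) :
  continuous g -> (forall x, 0 <= g x) ->
  (forall eps : R, 0 < eps -> exists w dw : 'I_d -> 'rV[R]_d -> R,
    [/\ forall i, Defs.periodic (w i),
        forall i x, is_derive x (evec R i) (w i) (dw i x),
        forall i, continuous (dw i) &
        forall x, g x <= \sum_i dw i x + eps]) ->
  forall x, g x = 0.
Proof.
move=> gc g0 gdiv x; apply/eqP; case: (ltgtP (g x) 0) => //.
  by rewrite ltNge g0.
move=> gx0; exfalso.
have [M M0 gM] := pos_near_cube _ _ _ _ gc gx0.
set c := g x / 2 in gM; have c0 : 0 < c by rewrite divr_gt0.
have Md0 : 0 < (M ^ d)%:R :> R by rewrite ltr0n expn_gt0 M0.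
(* The bound [c] on a subcube of volume M^(-d) keeps every grid average of [g] above [tau]. The aim
   is an upper bound [tau / 2]: one quarter comes from the error in the hypothesis, one from the [d]
   derivative averages. *)
pose tau := c / (M ^ d)%:R; have tau0 : 0 < tau by rewrite divr_gt0.
have [|w [dw [wper wder dwc gle]]] := gdiv (tau / 4); first by rewrite divr_gt0.
(* The factor [d.+1] gives [d * delta <= tau / 4] and stays nonzero when [d = 0]. *)
pose delta := tau / (4 * d.+1%:R).
have delta0 : 0 < delta by rewrite divr_gt0// mulr_gt0// ltr0n.
(* This closed unit cube based at [x] contains all the grids, so the modulus [eta] is found before
   the mesh is chosen. *)
pose B := [set v : 'rV[R]_d | forall i, `[x 0 i, x 0 i + 1]%classic (v ord0 i)].
have cB : compact B.
  apply: (@rV_compact R d (fun i => `[x 0 i, x 0 i + 1]%classic)) => i.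
  exact: segment_compact.
have [eta eta0 small] := uniform_small_shift _ _ _ (@evec R d) dw B _ cB dwc delta0.
have [n n0 neta] := exists_inv_lt _ _ eta0.
have MnB k : B (grid R d x (M * n) k).
  move=> i; rewrite /= in_itv/= !mxE lerDl lerD2l divr_ge0//=.
  rewrite ler_pdivrMr ?ltr0n ?muln_gt0 ?M0// mul1r ler_nat.
  exact/ltnW/ltn_ord.
have Mn0 : (0 < M * n)%N by rewrite muln_gt0 M0.
have up i : \sum_k dw i (grid R d x (M * n) k) <= ((M * n) ^ d)%:R * delta.
  apply: (sum_grid_deriv_le _ _ (w i)) => // t k /andP[t0 tN].
  apply/ltW/small => //; rewrite gtr0_norm//.
  apply: (lt_trans tN); apply: (le_lt_trans _ neta).
  by rewrite lef_pV2 ?posrE ?ltr0n// ler_nat leq_pmull.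
have lo := sum_grid_ge R d g x M n c M0 n0 g0 gM.
have : \sum_k g (grid R d x (M * n) k) <=
    d%:R * (((M * n) ^ d)%:R * delta) + ((M * n) ^ d)%:R * (tau / 4).
  apply: (@le_trans _ _ (\sum_k (\sum_i dw i (grid R d x (M * n) k) + tau / 4))).
    by apply: ler_sum => k _; exact: gle.
  rewrite big_split/= exchange_big/=; apply: lerD.
    apply: (@le_trans _ _ (\sum_(i < d) (((M * n) ^ d)%:R * delta))).
      by apply: ler_sum => i _; exact: up.
    by rewrite sumr_const card_ord -[leLHS]mulr_natl.
  by rewrite sumr_const card_ffun !card_ord mulr_natl.
(* Multiplied by the number of grid points, [tau] becomes [n ^ d * c], so the upper bound is half of
   the lower one. *)
move/(le_trans lo); apply/negP; rewrite -ltNge.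
have E : ((M * n) ^ d)%:R * tau = (n ^ d)%:R * c :> R.
  by rewrite /tau expnMn natrM; field; rewrite gt_eqF.
have P0 : 0 < (n ^ d)%:R * c by rewrite mulr_gt0// ltr0n expn_gt0 n0.
have dd : d%:R * (((M * n) ^ d)%:R * delta) <= ((M * n) ^ d)%:R * (tau / 4).
  rewrite mulrCA ler_pM2l ?ltr0n ?expn_gt0 ?Mn0//.
  rewrite /delta invfM (mulrA tau) mulrCA ler_piMr ?divr_ge0 ?(ltW tau0)//.
  by rewrite ler_pdivrMr ?ltr0n// mul1r ler_nat.
have E4 : ((M * n) ^ d)%:R * (tau / 4) = (n ^ d)%:R * c / 4 :> R by rewrite [LHS]mulrA E.
apply: (le_lt_trans (lerD dd (lexx _))); rewrite E4; lra.
Qed.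

(** * Chain rule, second derivative test and a smooth sign function *)

Lemma is_derive_comp_dir (R : realType) (V : normedModType R) (psi : R -> R) (g : V -> R)
    (x v : V) (a dg : R) :
  is_derive (g x) 1 psi a -> is_derive x v g dg ->
  is_derive x v (fun y => psi (g y)) (a * dg).
Proof.
move=> psia gdg.
have x0 : 0 *: v + x = x by rewrite scale0r add0r.
have L : is_derive (0 : R) 1 (fun s : R => g (s *: v + x)) dg.
  by apply: is_derive_line; rewrite x0.
have C := @is_derive1_comp R psi (fun s : R => g (s *: v + x)) 0 a dg.
rewrite x0 in C; have [D1 D2] := C psia L.
split; first exact: ((@derivable1P R V R (fun y => psi (g y)) x v).2 D1).
rewrite -D2 /derive; apply: (congr1 (fun F => lim (F @ 0^'))).
by apply/funext => h /=; rewrite x0 addr0 [h *: 1]mulr1.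
Qed.

(** Were [c] positive, [dg], which vanishes at [x], would be positive just beyond [x] in direction
    [v], and the mean value theorem would produce a value of [g] above the maximum. *)
Lemma max_second_derivative (R : realType) (V : normedModType R) (g dg : V -> R) (x v : V) (c : R) :
  (forall y, is_derive y v g (dg y)) -> is_derive x v dg c ->
  (forall y, g y <= g x) -> dg x = 0 /\ c <= 0.
Proof.
move=> gdg dgc gmax.
have x0 : 0 *: v + x = x by rewrite scale0r add0r.
have L (s : R) : is_derive s 1 (fun s : R => g (s *: v + x)) (dg (s *: v + x)).
  exact: is_derive_line.
have dg0 : dg x = 0.
  have /(@derive_val _ _ _ _ _ _ _) : is_derive (0 : R) 1 (fun s : R => g (s *: v + x)) 0.
    apply: (@derive1_at_max R _ (-1) 1 0).
    - by lra.
    - by move=> t _; apply: (@ex_derive _ _ _ _ _ _ _ (L t)).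
    - by rewrite in_itv /=; lra.
    - by move=> t _; rewrite x0.
  by rewrite (@derive_val _ _ _ _ _ _ _ (L 0)) x0.
split=> //; rewrite leNgt; apply/negP => c0.
have [dgx dgE] := dgc.
have := dgx; rewrite /derivable => /cvgrPdist_lt.
rewrite -[lim _]/('D_v dg x) dgE => /(_ _ c0); rewrite near_withinE.
move=> /nbhs_ballP [r /= r0 H].
have r2 : 0 < r / 2 by rewrite divr_gt0.
have [s /andP[s0 sr] E] := directional_MVT _ _ g dg x v (r / 2) r2 gdg.
have := H s; rewrite /ball /= sub0r normrN gtr0_norm// => /(_ _ _).
have -> : s < r by lra.
rewrite gt_eqF// dg0 subr0 => /(_ isT isT).
rewrite ltr_distl => /andP[_]; rewrite [_ *: _]mulrC => Hs.
have dgs : 0 < dg (s *: v + x).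
  have : 0 < dg (s *: v + x) / s by lra.
  by rewrite pmulr_lgt0// invr_gt0.
have := gmax ((r / 2) *: v + x); rewrite -subr_le0 E leNgt.
by rewrite mulr_gt0.
Qed.

(** Take psi(s) = s / r with r = sqrt(s^2 + e^2), so that psi' = e^2 / r^3. All bounds follow from
    |s| <= r and e <= r; the last one uses s psi(s) = r - e^2 / r. *)
Lemma sign_approx (R : realType) (e : R) : 0 < e ->
  exists psi dpsi : R -> R,
    (forall s : R, is_derive s 1 psi (dpsi s)) /\ continuous dpsi /\
    (forall s, psi s <= 1 /\ 0 <= dpsi s /\ s ^+ 2 * dpsi s <= e /\ `|s| - e <= s * psi s).
Proof.
move=> e0.
pose r (s : R) := Num.sqrt (s ^+ 2 + e ^+ 2).
have q0 s : 0 < s ^+ 2 + e ^+ 2 by rewrite ltr_wpDl ?sqr_ge0// exprn_gt0.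
have r0 s : 0 < r s by rewrite sqrtr_gt0.
have rE s : r s ^+ 2 = s ^+ 2 + e ^+ 2 by rewrite sqr_sqrtr ?ltW.
have rd (s : R) : is_derive s 1 r (s / r s).
  have Q : is_derive s 1 (fun y : R => y ^+ 2 + e ^+ 2) (2 * s).
    apply: is_derive_eq; rewrite addr0 /GRing.scale/=; ring.
  have := @is_derive1_comp R Num.sqrt _ s _ _ (is_derive1_sqrt (q0 s)) Q.
  move/is_derive_eq; apply; rewrite -/(r s); field.
  by rewrite gt_eqF.
have psid (s : R) : is_derive s 1 (fun y => y * (r y)^-1) (e ^+ 2 / r s ^+ 3).
  have rN : r s != 0 by rewrite gt_eqF.
  have V := is_deriveV rN (rd s).
  have M := @is_deriveM R _ id (fun y => (r y)^-1) s 1 1 _ (is_derive_id _ _) V.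
  apply: (is_derive_eq M); rewrite /GRing.scale/=.
  have -> : e ^+ 2 = r s ^+ 2 - s ^+ 2 by rewrite rE addrC addKr.
  by field.
exists (fun y => y * (r y)^-1), (fun s => e ^+ 2 / r s ^+ 3); split => //; split.
  move=> s; apply: cvgM; first exact: cvg_cst.
  apply: cvgV; first by rewrite expf_neq0// gt_eqF.
  apply: (@continuous_comp _ _ _ r (fun y : R => y ^+ 3)); last exact: exprn_continuous.
  exact/differentiable_continuous/derivable1_diffP/(@ex_derive _ _ _ _ _ _ _ (rd s)).
move=> s.
have sr : `|s| <= r s.
  by rewrite -sqrtr_sqr ler_sqrt ?(ltW (q0 s))// lerDl sqr_ge0.
have er : e <= r s.
  by rewrite -[leLHS]ger0_norm ?(ltW e0)// -sqrtr_sqr ler_sqrt ?(ltW (q0 s))// lerDr sqr_ge0.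
split; first by rewrite ler_pdivrMr// mul1r (le_trans (ler_norm _)).
split; first by rewrite divr_ge0 ?exprn_ge0 ?ltW.
split.
  rewrite mulrA ler_pdivrMr ?exprn_gt0//.
  have s2 : s ^+ 2 <= r s ^+ 2 by rewrite rE lerDl sqr_ge0.
  have -> : e * r s ^+ 3 = r s ^+ 2 * (e * r s) by ring.
  by apply: ler_pM => //; rewrite ?sqr_ge0// expr2 ler_pM2l.
rewrite mulrA -expr2 -[s ^+ 2](addrK (e ^+ 2)) -rE mulrBl.
have -> : r s ^+ 2 / r s = r s by rewrite expr2 mulfK// gt_eqF.
apply: lerB => //; by rewrite ler_pdivrMr// expr2 ler_pM2l.
Qed.

Lemma is_derive_mul (R : realType) (V : normedModType R) (f g : V -> R) (x v : V) (a b : R) :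
  is_derive x v f a -> is_derive x v g b ->
  is_derive x v (fun y => f y * g y) (a * g x + f x * b).
Proof.
move=> fa gb; apply: (is_derive_eq (is_deriveM fa gb)).
by rewrite /GRing.scale/= addrC mulrC.
Qed.

(** * Partial derivatives of C^2 functions *)

Section PartialDerivatives.
Variables (R : realType) (d : nat).
Implicit Types (g : 'rV[R]_d -> R) (x : 'rV[R]_d).

Lemma pd_periodic g i : Defs.periodic g -> Defs.periodic (pd i g).
Proof.
move=> gper x j; rewrite /pd /derive.
apply: (congr1 (fun F => lim (F @ 0^'))); apply/funext => h /=.
by rewrite addrA !gper.
Qed.

Lemma C2_is_derive g x i : isC2 g -> is_derive x (evec R i) g (pd i g x).
Proof. by case=> _ [D _]; apply: derivableP. Qed.

Lemma C2_is_derive_pd g x i j : isC2 g ->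
  is_derive x (evec R j) (pd i g) (pd j (pd i g) x).
Proof. by case=> _ [_ [_ [D _]]]; apply: derivableP. Qed.

Lemma pdE g x i (a : R) : is_derive x (evec R i) g a -> pd i g x = a.
Proof. by move=> D; exact: (@derive_val _ _ _ _ _ _ _ D). Qed.

End PartialDerivatives.

(* Unification would otherwise try to unfold the limits defining partial derivatives. *)
Local Opaque pd.

(** * Periodic functions: maxima and differential identities *)

Section Torus.
Variables (R : realType) (d : nat).
Implicit Types (g h : 'rV[R]_d -> R) (x : 'rV[R]_d).

Lemma periodic_sub g x i : Defs.periodic g -> g (x - evec R i) = g x.
Proof. by move=> gper; rewrite -(gper (x - evec R i) i) subrK. Qed.

Lemma periodic_int g x (z : 'I_d -> int) : Defs.periodic g ->
  g (x + \row_i (z i)%:~R) = g x.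
Proof.
move=> gper.
have -> : \row_i (z i)%:~R = \sum_i (z i)%:~R *: evec R i.
  apply/rowP => j; rewrite mxE summxE (bigD1 j)//= big1 ?addr0.
    by rewrite !mxE eqxx mulr1.
  by move=> i ij; rewrite !mxE (negPf ij) mulr0.
move: x; elim/big_ind: _ => [x|v w IHv IHw x|i _ x].
- by rewrite addr0.
- by rewrite addrA IHw IHv.
- rewrite scaler_int; case: (z i) => n; rewrite ?NegzE ?mulrNz -pmulrn.
    by elim: n => [|n IHn]; rewrite ?mulr0n ?addr0// mulrSr addrA gper.
  by elim: n.+1 => [|k IHk]; rewrite ?mulr0n ?oppr0 ?addr0// mulrSr opprD addrA periodic_sub.
Qed.

Lemma periodic_unit_cube x : exists2 y : 'rV[R]_d, (forall i, 0 <= y 0 i <= 1) &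
  forall g, Defs.periodic g -> g x = g y.
Proof.
exists (x + \row_i (- Num.floor (x 0 i))%:~R) => [i|g gper]; last first.
  by rewrite (periodic_int _ _ (fun i => - Num.floor (x 0 i))).
rewrite !mxE mulrNz subr_ge0 Num.Theory.floor_le_tmp/= lerBlDr addrC.
by have := floorD1_gt (x 0 i); rewrite intrD => /ltW.
Qed.

Lemma periodic_max g : continuous g -> Defs.periodic g ->
  exists x, forall y, g y <= g x.
Proof.
move=> gc gper.
pose B := [set v : 'rV[R]_d | forall i, `[0 : R, 1]%classic (v ord0 i)].
have cB : compact B.
  apply: (@rV_compact R d (fun=> `[0 : R, 1]%classic)) => i.
  exact: segment_compact.
have [||x _ xmax] := @EVT_max_rV R d g B _ cB.
- by exists 0 => i; rewrite /= in_itv/= mxE lexx ler01.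
- exact: continuous_subspaceT.
exists x => y; have [z z01 ->//] := periodic_unit_cube y.
by apply: xmax; rewrite inE => i; rewrite /= in_itv/=; exact: z01.
Qed.

Lemma pdN g i : isC2 g -> pd i (fun x => - g x) = fun x => - pd i g x.
Proof.
move=> g2; apply/funext => x; apply: pdE.
exact: is_deriveN (C2_is_derive _ _ g x i g2).
Qed.

Lemma pdNpd g i j : isC2 g -> pd j (fun x => - pd i g x) = fun x => - pd j (pd i g) x.
Proof.
move=> g2; apply/funext => x; apply: pdE.
exact: is_deriveN (C2_is_derive_pd _ _ g x i j g2).
Qed.

Lemma isC2N g : isC2 g -> isC2 (fun x => - g x).
Proof.
move=> g2; have [c [D [cp [Dp cpp]]]] := g2.
split; first by move=> x; exact: (continuousN (c x)).
split; first by move=> i x; apply: derivableN; exact: D.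
split; first by move=> i; rewrite pdN// => x; exact: (continuousN (cp i x)).
split; first by move=> i j x; rewrite pdN//; apply: derivableN; exact: Dp.
by move=> i j; rewrite pdN// pdNpd// => x; exact: (continuousN (cpp i j x)).
Qed.

Lemma lapN g x : isC2 g -> lap (fun x => - g x) x = - lap g x.
Proof.
by move=> g2; rewrite /lap -sumrN; apply: eq_bigr => i _; rewrite pdN// pdNpd.
Qed.

Lemma gdotNr h g x : isC2 g -> gdot h (fun x => - g x) x = - gdot h g x.
Proof.
by move=> g2; rewrite /gdot -sumrN; apply: eq_bigr => i _; rewrite pdN// mulrN.
Qed.

Lemma is_derive_flux a b x i j : isC2 a -> isC2 b ->
  is_derive x (evec R j) (fun y => a y * pd i b y)
    (pd j a x * pd i b x + a x * pd j (pd i b) x).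
Proof.
move=> a2 b2.
by apply: is_derive_mul; [exact: C2_is_derive|exact: C2_is_derive_pd].
Qed.

Lemma divmulE a b x : isC2 a -> isC2 b -> divmul a b x = gdot a b x + a x * lap b x.
Proof.
move=> a2 b2; rewrite /divmul /gdot /lap mulr_sumr -big_split/=.
apply: eq_bigr => i _; apply: pdE; exact: is_derive_flux.
Qed.

Lemma gdotC g h x : gdot g h x = gdot h g x.
Proof. by apply: eq_bigr => i _; rewrite mulrC. Qed.

Lemma divmulNl a b x : isC2 a -> isC2 b ->
  divmul (fun x => - a x) b x = - divmul a b x.
Proof.
move=> a2 b2; rewrite (divmulE _ b x (isC2N _ a2) b2) (divmulE a b x a2 b2).
by rewrite gdotC (gdotNr _ _ _ a2) gdotC; move: (gdot a b x) (a x) (lap b x) => p q r; ring.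
Qed.

Lemma gdot_ge0 g x : 0 <= gdot g g x.
Proof. by apply: sumr_ge0 => i _; rewrite -expr2 sqr_ge0. Qed.

Lemma C2_max g : isC2 g -> Defs.periodic g -> exists x,
  [/\ forall y, g y <= g x, forall i, pd i g x = 0 & lap g x <= 0].
Proof.
move=> g2 gper; have [x xmax] := periodic_max g g2.1 gper.
have H i : pd i g x = 0 /\ pd i (pd i g) x <= 0.
  apply: (max_second_derivative _ _ g (pd i g) x (evec R i)) => //.
    by move=> y; exact: C2_is_derive.
  exact: C2_is_derive_pd.
exists x; split => // [i|]; first by case: (H i).
rewrite /lap; apply: sumr_le0 => i _; by case: (H i).
Qed.

Lemma gdot0l g h x : (forall i, pd i g x = 0) -> gdot g h x = 0.
Proof. by move=> g0; apply: big1 => i _; rewrite g0 mul0r. Qed.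

End Torus.

Lemma continuous_mul (R : realType) (T : topologicalType) (f g : T -> R) :
  continuous f -> continuous g -> continuous (fun x => f x * g x).
Proof. by move=> fc gc x; apply: cvgM; [exact: fc|exact: gc]. Qed.

Lemma continuous_add (R : realType) (T : topologicalType) (f g : T -> R) :
  continuous f -> continuous g -> continuous (fun x => f x + g x).
Proof. by move=> fc gc x; apply: cvgD; [exact: fc|exact: gc]. Qed.

(** * Sign and uniqueness for the transport and drift equations *)

Section TestFunctions.
Variables (R : realType) (d : nat).
Implicit Types (x : 'rV[R]_d).

(** The expression is |Da + c Db|^2 at [x]. As the inequality is pointwise, [c] may be the value of
    a function at [x]; this is how drift and coupling terms are absorbed by completing squares. *)
Lemma gdot_square_ge0 (a b : 'rV[R]_d -> R) x (c : R) :
  0 <= gdot a a x + 2 * c * gdot a b x + c ^+ 2 * gdot b b x.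
Proof.
rewrite /gdot !mulr_sumr -!big_split/=; apply: sumr_ge0 => i _.
move: (pd i a x) (pd i b x) => p q.
have -> : p * p + 2 * c * (p * q) + c ^+ 2 * (q * q) = (p + c * q) ^+ 2 by ring.
exact: sqr_ge0.
Qed.

Lemma periodicN (g : 'rV[R]_d -> R) : Defs.periodic g -> Defs.periodic (fun x => - g x).
Proof. by move=> gper x i; rewrite gper. Qed.

(* Testing the transport equation against [psi rho - 1], with [psi] a smooth
   approximation of the sign, kills the drift term in the limit. *)
Lemma transport_ge0 (u rho : 'rV[R]_d -> R) (lambda K : R) :
  0 < lambda -> isC2 u -> Defs.periodic u -> isC2 rho -> Defs.periodic rho ->
  (forall x, gdot u u x <= K ^+ 2) ->
  (forall x, 0 <= - lap rho x - divmul rho u x + lambda * rho x) ->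
  forall x, 0 <= rho x.
Proof.
move=> l0 u2 uper r2 rper uK rge0 x.
suff : lambda * (`|rho x| - rho x) = 0.
  move/eqP; rewrite mulf_eq0 gt_eqF//= subr_eq0 => /eqP <-; exact: normr_ge0.
move: x; apply: (nonneg_le_div_eq0 R d (fun x => lambda * (`|rho x| - rho x))).
- apply: continuous_mul; first exact: cst_continuous.
  apply: continuous_add; last by move=> x; exact: (continuousN (r2.1 x)).
  by move=> x; apply: (cvg_norm (r2.1 x)).
- by move=> x; rewrite mulr_ge0 ?(ltW l0)// subr_ge0 ler_norm.
move=> eps eps0.
have den0 : 0 < K ^+ 2 / 4 + lambda by rewrite ltr_wpDl// divr_ge0 ?sqr_ge0.
(* The error has two sources. Completing the square in the drift term leaves psi'(rho) rho^2 |Du|^2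
   / 4 <= e K^2 / 4, and replacing rho psi(rho) by |rho| costs [lambda * e]. *)
pose e := eps / (K ^+ 2 / 4 + lambda).
have e0 : 0 < e by rewrite divr_gt0.
have eE : eps = e * (K ^+ 2 / 4 + lambda) by rewrite divfK// gt_eqF.
have [psi [dpsi [psid [dpsic psiP]]]] := sign_approx _ e e0.
have psic : continuous psi.
  move=> s; apply/differentiable_continuous/derivable1_diffP.
  exact: (@ex_derive _ _ _ _ _ _ _ (psid s)).
(* [F] is the flux D rho + rho Du of the transport operator, and [dF i] is the [i]-th derivative of
   its [i]-th component. *)
pose F i x := pd i rho x + rho x * pd i u x.
pose dF i x := pd i (pd i rho) x + (pd i rho x * pd i u x + rho x * pd i (pd i u) x).
exists (fun i x => (psi (rho x) - 1) * F i x),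
  (fun i x => (dpsi (rho x) * pd i rho x) * F i x + (psi (rho x) - 1) * dF i x).
have [rc [_ [rpc [_ rppc]]]] := r2.
have [uc [_ [upc [_ uppc]]]] := u2.
have psirc : continuous (fun x => psi (rho x) - 1).
  apply: continuous_add; last exact: cst_continuous.
  by move=> x; apply: continuous_comp; [exact: rc|exact: psic].
have dpsirc : continuous (fun x => dpsi (rho x)).
  by move=> x; apply: continuous_comp; [exact: rc|exact: dpsic].
split.
- move=> i x j; rewrite /F rper.
  by rewrite (pd_periodic _ _ rho i rper) (pd_periodic _ _ u i uper).
- move=> i x; apply: is_derive_mul.
    have := is_derive_comp_dir _ _ psi rho x (evec R i) _ _ (psid (rho x)) (C2_is_derive _ _ rho x i r2).
    move=> D; apply: (is_derive_eq (is_deriveB D (is_derive_cst _ _ _))).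
    exact: subr0.
  apply: is_deriveD; first exact: C2_is_derive_pd.
  exact: is_derive_flux.
- move=> i; apply: continuous_add; apply: continuous_mul.
  + exact: continuous_mul.
  + by apply: continuous_add => //; exact: continuous_mul.
  + exact: psirc.
  + apply: continuous_add => //; apply: continuous_add; exact: continuous_mul.
move=> x.
have -> : \sum_(i < d) ((dpsi (rho x) * pd i rho x) * F i x + (psi (rho x) - 1) * dF i x)
    = dpsi (rho x) * (gdot rho rho x + rho x * gdot rho u x)
      + (psi (rho x) - 1) * (lap rho x + divmul rho u x).
  rewrite (divmulE _ _ rho u x r2 u2) /gdot /lap.
  rewrite !mulr_sumr -!big_split/= !mulr_sumr -!big_split/=.
  apply: eq_bigr => i _; rewrite /F /dF.
  move: (pd i rho x) (pd i u x) (pd i (pd i rho) x) (pd i (pd i u) x) => p q r s.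
  by ring.
have [psi1 [dpsi0 [dpsie psirho]]] := psiP (rho x).
have := gdot_square_ge0 rho u x (rho x / 2).
move: (rge0 x) (uK x) (gdot_ge0 _ _ u x) => /=.
move: (gdot rho rho x) (gdot rho u x) (gdot u u x) (lap rho x) (divmul rho u x).
move=> grr gru guu lr dr h0 guuK guu0 sq0.
rewrite eE.
move: (rho x) (dpsi _) (psi _) psi1 dpsi0 dpsie psirho h0 sq0 => r D p psi1 dpsi0 dpsie psirho h0 sq0.
have H1 : 0 <= D * (grr + 2 * (r / 2) * gru + (r / 2) ^+ 2 * guu) by exact: mulr_ge0.
have H2 : 0 <= (1 - p) * (- lr - dr + lambda * r) by rewrite mulr_ge0// subr_ge0.
have H3 : r ^+ 2 * D * guu <= e * K ^+ 2.
  by apply: ler_pM => //; rewrite mulr_ge0// sqr_ge0.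
have H4 : 0 <= lambda * (r * p - (`|r| - e)) by rewrite mulr_ge0 ?(ltW l0)// subr_ge0.
rewrite -subr_ge0.
have -> : D * (grr + r * gru) + (p - 1) * (lr + dr) + e * (K ^+ 2 / 4 + lambda) -
  lambda * (`|r| - r) = D * (grr + 2 * (r / 2) * gru + (r / 2) ^+ 2 * guu)
   + (1 - p) * (- lr - dr + lambda * r) + (e * K ^+ 2 - r ^+ 2 * D * guu) / 4
   + lambda * (r * p - (`|r| - e)) by field.
by rewrite !addr_ge0// divr_ge0// subr_ge0.
Qed.

(** The equation is linear, so the sign result applies to both [rho] and [- rho]. *)
Lemma transport_eq0 (u rho : 'rV[R]_d -> R) (lambda K : R) :
  0 < lambda -> isC2 u -> Defs.periodic u -> isC2 rho -> Defs.periodic rho ->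
  (forall x, gdot u u x <= K ^+ 2) ->
  (forall x, - lap rho x - divmul rho u x + lambda * rho x = 0) ->
  forall x, rho x = 0.
Proof.
move=> l0 u2 uper r2 rper uK req0 x.
have rge : 0 <= rho x.
  apply: (transport_ge0 u rho lambda K l0 u2 uper r2 rper uK) => y.
  by rewrite req0.
have : 0 <= - rho x.
  apply: (transport_ge0 u (fun x => - rho x) lambda K l0 u2 uper (isC2N _ _ _ r2)
    (periodicN _ rper) uK) => y.
  rewrite (lapN _ _ _ _ r2) (divmulNl _ _ _ _ _ r2 u2).
  by have := req0 y; lra.
rewrite oppr_ge0 => rle; apply/eqP; by rewrite eq_le rge rle.
Qed.

(** Maximum principle: where [v] is largest, the gradient vanishes and the Laplacian is nonpositive,
    which leaves [lambda * v <= 0]. *)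
Lemma drift_le0 (u v : 'rV[R]_d -> R) (lambda : R) :
  0 < lambda -> isC2 v -> Defs.periodic v ->
  (forall x, - lap v x + gdot u v x + lambda * v x <= 0) -> forall x, v x <= 0.
Proof.
move=> l0 v2 vper H x.
have [y [ymax dv0 lapv]] := C2_max _ _ v v2 vper.
apply: (le_trans (ymax x)).
have := H y; rewrite gdotC gdot0l// addr0 => Hy.
have : lambda * v y <= 0 by lra.
by rewrite pmulr_rle0.
Qed.

Lemma drift_eq0 (u v : 'rV[R]_d -> R) (lambda : R) :
  0 < lambda -> isC2 v -> Defs.periodic v ->
  (forall x, - lap v x + gdot u v x + lambda * v x = 0) -> forall x, v x = 0.
Proof.
move=> l0 v2 vper H x; apply/eqP; rewrite eq_le.
rewrite (drift_le0 u v lambda l0 v2 vper)/=; last by move=> y; rewrite H.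
rewrite -oppr_le0; apply: (drift_le0 u (fun x => - v x) lambda l0 (isC2N _ _ _ v2) (periodicN _ vper)) => y.
rewrite (lapN _ _ _ _ v2) (gdotNr _ _ _ _ _ v2).
by have := H y; lra.
Qed.

End TestFunctions.

(** * A priori bounds and the energy identity *)

Lemma le_supnorm (R : realType) (T : Type) (g : T -> R) :
  (exists C, forall x, `|g x| <= C) -> forall x, `|g x| <= supnorm g.
Proof.
move=> [C gC] x; apply: ub_le_sup; last by exists x.
by exists C => _ [y _ <-].
Qed.

(** Every point has a representative in the unit cube, at distance at most 1 from the origin because
    the norm on row vectors is the maximum norm. *)
Lemma holder_bounded (R : realType) (d : nat) (alpha : R) (g : 'rV[R]_d -> R) :
  0 < alpha -> Defs.periodic g ->
  (exists C, forall x y, `|g x - g y| <= C * (`|x - y| `^ alpha)) ->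
  exists C, forall x, `|g x| <= C.
Proof.
move=> a0 gper [C gC]; exists (`|g 0| + `|C|) => x.
have [y y01 ->//] := periodic_unit_cube _ _ x.
rewrite -[X in `|X|](subrK (g 0)) addrC (le_trans (ler_normD _ _))// lerD2l.
apply: (le_trans (gC y 0)); rewrite subr0.
have y1 : `|y| <= 1.
  rewrite [`|y|]mx_normrE; apply: bigmax_le => // -[i j] _ /=.
  by rewrite ord1 ger0_norm; have /andP[] := y01 j.
have p1 : `|y| `^ alpha <= 1.
  have := @ge0_ler_powR R alpha (ltW a0) `|y| 1.
  by rewrite powR1 !nnegrE; apply.
apply: (le_trans (ler_wpM2r (powR_ge0 _ _) (ler_norm C))).
by rewrite ler_piMr.
Qed.

Section Energy.
Variables (R : realType) (d : nat).
Implicit Types (x : 'rV[R]_d).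

Lemma continuous_gdot (a b : 'rV[R]_d -> R) : isC2 a -> isC2 b -> continuous (gdot a b).
Proof.
move=> [_ [_ [apc _]]] [_ [_ [bpc _]]]; rewrite /gdot.
elim: (index_enum _) => [|i s IHs].
  rewrite (_ : (fun x => _) = cst 0); first exact: cst_continuous.
  by apply/funext => x; rewrite big_nil.
rewrite (_ : (fun x => _) = fun x =>
  pd i a x * pd i b x + \sum_(j <- s) pd j a x * pd j b x).
  by apply: continuous_add => //; exact: continuous_mul.
by apply/funext => x; rewrite big_cons.
Qed.

(** This expands the divergence of q (D rho + rho Du + m Dv) + kappa r Dv. The choice (q, r, kappa)
    = (v, rho, -1) serves the monotone case, and (rho, v, 4 mu^2) the case of large [lambda]. *)
Lemma divergence_pairing (u m v rho q r : 'rV[R]_d -> R) (kappa : R) :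
  isC2 u -> isC2 m -> isC2 v -> isC2 rho -> isC2 q -> isC2 r ->
  Defs.periodic u -> Defs.periodic m -> Defs.periodic v -> Defs.periodic rho ->
  Defs.periodic q -> Defs.periodic r ->
  exists w dw : 'I_d -> 'rV[R]_d -> R,
    [/\ forall i, Defs.periodic (w i),
        forall i x, is_derive x (evec R i) (w i) (dw i x),
        forall i, continuous (dw i) &
        forall x, \sum_i dw i x =
          gdot q rho x + rho x * gdot q u x + m x * gdot q v x
          + q x * (lap rho x + divmul rho u x + divmul m v x)
          + kappa * (gdot r v x + r x * lap v x)].
Proof.
move=> u2 m2 v2 rho2 q2 r2 uper mper vper rhoper qper rper.
pose F i x := pd i rho x + rho x * pd i u x + m x * pd i v x.
pose dF i x := pd i (pd i rho) x + (pd i rho x * pd i u x + rho x * pd i (pd i u) x)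
  + (pd i m x * pd i v x + m x * pd i (pd i v) x).
exists (fun i x => q x * F i x + kappa * (r x * pd i v x)),
  (fun i x => (pd i q x * F i x + q x * dF i x)
     + kappa * (pd i r x * pd i v x + r x * pd i (pd i v) x)).
have [uc [_ [upc [_ uppc]]]] := u2.
have [mc [_ [mpc [_ mppc]]]] := m2.
have [vc [_ [vpc [_ vppc]]]] := v2.
have [rhoc [_ [rhopc [_ rhoppc]]]] := rho2.
have [qc [_ [qpc [_ _]]]] := q2.
have [rc [_ [rpc [_ _]]]] := r2.
split.
- move=> i x j; rewrite /F rhoper mper qper rper (pd_periodic _ _ rho i rhoper).
  by rewrite (pd_periodic _ _ u i uper) (pd_periodic _ _ v i vper).
- move=> i x; apply: is_deriveD.
    apply: is_derive_mul; first exact: C2_is_derive.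
    apply: is_deriveD; last exact: is_derive_flux.
    apply: is_deriveD; last exact: is_derive_flux.
    exact: C2_is_derive_pd.
  apply: is_deriveZ; exact: is_derive_flux.
- move=> i; apply: continuous_add.
    apply: continuous_add; apply: continuous_mul.
    + exact: qpc.
    + apply: continuous_add; first apply: continuous_add.
      * exact: rhopc.
      * exact: continuous_mul.
      * exact: continuous_mul.
    + exact: qc.
    + apply: continuous_add; first apply: continuous_add.
      * exact: rhoppc.
      * apply: continuous_add; exact: continuous_mul.
      * apply: continuous_add; exact: continuous_mul.
  apply: continuous_mul; first exact: cst_continuous.
  apply: continuous_add; exact: continuous_mul.
move=> x.
rewrite (divmulE _ _ rho u x rho2 u2) (divmulE _ _ m v x m2 v2) /gdot /lap.
rewrite !mulr_sumr -!big_split/= !mulr_sumr -!big_split/=.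
apply: eq_bigr => i _; rewrite /F /dF.
move: (pd i q x) (pd i r x) (pd i m x) (pd i (pd i rho) x) (pd i (pd i u) x) (pd i (pd i v) x).
move: (pd i rho x) (pd i u x) (pd i v x) => *; by ring.
Qed.

(** At a maximum of [u] the first equation gives lambda u <= Fn, hence Delta u <= M := 2 Fn + K^2 /
    2 everywhere. At a maximum of [m] the second then gives (lambda - M) m <= lambda mu, and M <
    lambda / 2 concludes. *)
Lemma mfg_density_le (f : R -> R) (lambda K mu Fn : R) (m0 u m : 'rV[R]_d -> R) :
  0 < lambda -> 2 * (2 * Fn + K ^+ 2 / 2) < lambda ->
  (forall x, `|m0 x| <= mu) -> (forall s, `|f s| <= Fn) ->
  (forall x, gdot u u x <= K ^+ 2) -> (forall x, 0 <= m x) ->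
  MFG_solution f lambda m0 u m -> forall x, m x <= 2 * mu.
Proof.
move=> l0 lM m0mu fF uK mge [uper [mper [u2 [m2 [equ eqm]]]]] x.
have Fb s : - Fn <= f s <= Fn by rewrite -ler_norml.
have ule y : lambda * u y <= Fn.
  have [z [zmax du0 lapu]] := C2_max _ _ u u2 uper.
  have := equ z; rewrite (gdot0l _ _ _ _ _ du0) mul0r addr0.
  have /andP[_ f1] := Fb (m z).
  have : lambda * u y <= lambda * u z by rewrite ler_pM2l.
  move: lapu f1; move: (lap u z) => L; lra.
have [z [zmax dm0 lapm]] := C2_max _ _ m m2 mper.
apply: (le_trans (zmax x)).
have := eqm z; rewrite (divmulE _ _ m u z m2 u2) (gdot0l _ _ _ _ _ dm0) add0r.
have /(le_trans (ler_norm _)) m0z := m0mu z.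
have := equ z; have /andP[fz _] := Fb (m z).
have := uK z; have := ule z; have mz := mge z.
move: (lap m z) (lap u z) (gdot u u z) lapm => Lm Lu G lapm uz Gk Eu Em.
have LuM : 0 <= (2 * Fn + K ^+ 2 / 2 - Lu) * m z by apply: mulr_ge0 => //; lra.
have H1 : lambda * m z - (2 * Fn + K ^+ 2 / 2) * m z <= lambda * mu.
  have : lambda * m0 z <= lambda * mu by rewrite ler_pM2l.
  by move: Em LuM; rewrite mulrBl (mulrC Lu); lra.
have H2 : 0 <= (lambda / 2 - (2 * Fn + K ^+ 2 / 2)) * m z by apply: mulr_ge0 => //; lra.
rewrite -(ler_pM2l l0).
by move: H1 H2; rewrite mulrBl; lra.
Qed.

End Energy.

(** * Stability for monotone coupling or large [lambda] *)

Theorem theorem2p9 (R : realType) (d : nat) (lambda alpha : R)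
  (m0 : 'rV[R]_d -> R) (f : R -> R) (u m : 'rV[R]_d -> R) (K : R) :
  0 < lambda -> 0 < alpha < 1 ->
  holder_prob_density alpha m0 ->
  C1b f ->
  MFG_solution f lambda m0 u m ->
  0 < K ->
  (* K: the gradient bound of Proposition 2.4, uniform in lambda *)
  (forall (lambda' : R) (u' m' : 'rV[R]_d -> R), 0 < lambda' ->
     MFG_solution f lambda' m0 u' m' -> forall x, grad_norm u' x <= K) ->
  let M := 2 * supnorm f + K ^+ 2 / 2 in
  let Lambda := Num.max (2 * M) (K ^+ 2 / 2 + supnorm m0 * supnorm ((derive1 f))) in
  (forall s, 0 <= (derive1 f) s) \/ Lambda < lambda ->
  stable f lambda u m.
Proof.
move=> l0 /andP[a0 _] [m0per [m0h [m0ge _]]] [_ [dfc [fb dfb]]] sol K0 Kgrad M Lambda cond.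
move=> v rho [vper [rhoper [v2 [rho2 [eqv eqrho]]]]].
have uK x : gdot u u x <= K ^+ 2.
  rewrite -[gdot u u x]sqr_sqrtr; last exact: gdot_ge0.
  have Kx := Kgrad _ _ _ l0 sol x.
  by rewrite lerXn2r ?nnegrE ?sqrtr_ge0 ?(ltW K0).
have m0b := le_supnorm _ _ m0 (holder_bounded _ _ _ _ a0 m0per m0h).
have fF := le_supnorm _ _ f fb.
have dfF := le_supnorm _ _ (derive1 f) dfb.
have [uper [mper [u2 [m2 [equ eqm]]]]] := sol.
have mge : forall x, 0 <= m x.
  apply: (transport_ge0 _ _ u m lambda K l0 u2 uper m2 mper uK) => x.
  by rewrite eqm mulr_ge0 ?(ltW l0).
have dfmc : continuous (fun x => derive1 f (m x)).
  by move=> x; apply: continuous_comp; [exact: m2.1|exact: dfc].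
have lapvE x : lap v x = gdot u v x + lambda * v x - derive1 f (m x) * rho x.
  by have := eqv x; move: (lap v x) (gdot u v x) => p q; lra.
have laprhoE x : lap rho x + divmul rho u x + divmul m v x = lambda * rho x.
  by have := eqrho x; move: (lap rho x) (divmul rho u x) (divmul m v x) => p q r; lra.
(* Once [rho] vanishes, [v] solves the homogeneous drift equation and vanishes by the maximum
   principle. *)
suff rho0 : forall x, rho x = 0.
  split; apply/funext => x; last exact: rho0.
  apply: (drift_eq0 _ _ u v lambda l0 v2 vper) => y.
  by rewrite eqv rho0 mulr0.
case: cond => [df0|lLambda].
  have E x : derive1 f (m x) * rho x ^+ 2 + m x * gdot v v x = 0.
    move: x; apply: nonneg_le_div_eq0.
    - apply: continuous_add; apply: continuous_mul => //.
      + by apply: continuous_mul; exact: rho2.1.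
      + exact: m2.1.
      + exact: continuous_gdot.
    - by move=> x; rewrite addr_ge0// mulr_ge0 ?sqr_ge0//; exact: gdot_ge0.
    move=> eps eps0.
    (* With weight -1 the terms in Dv . D rho, in rho Du . Dv and in lambda v rho cancel, so the
       divergence equals the tested function exactly. *)
    have [w [dw [wper wder dwc dwE]]] := divergence_pairing _ _ u m v rho v rho (-1)
      u2 m2 v2 rho2 v2 rho2 uper mper vper rhoper vper rhoper.
    exists w, dw; split=> // x; rewrite dwE laprhoE lapvE (gdotC _ _ rho v) (gdotC _ _ v u).
    move: (gdot v rho x) (gdot u v x) (gdot v v x) => p q s.
    rewrite -subr_ge0 [leRHS](_ : _ = eps) ?(ltW eps0)//; ring.
  have E0 x : derive1 f (m x) * rho x ^+ 2 = 0 /\ m x * gdot v v x = 0.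
    have := E x; have : 0 <= m x * gdot v v x.
      by rewrite mulr_ge0//; exact: gdot_ge0.
    have : 0 <= derive1 f (m x) * rho x ^+ 2 by rewrite mulr_ge0 ?sqr_ge0.
    move: (gdot v v x) => p; lra.
  (* At each point [m] or Dv is zero, so the flux m Dv vanishes identically and [rho] solves the
     homogeneous transport equation. *)
  have mdv0 x : divmul m v x = 0.
    apply: big1 => i _; apply: pdE.
    rewrite (_ : (fun y => m y * pd i v y) = cst 0); first exact: is_derive_cst.
    apply/funext => y /=; apply/eqP; rewrite mulf_eq0.
    have [_ /eqP] := E0 y; rewrite mulf_eq0 => /orP[->//|].
    rewrite /gdot psumr_eq0; last by move=> j _; rewrite -expr2 sqr_ge0.
    move/allP => /(_ i); rewrite mem_index_enum => /(_ isT).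
    by rewrite implyTb -expr2 sqrf_eq0 => ->; rewrite orbT.
  apply: (transport_eq0 _ _ u rho lambda K l0 u2 uper rho2 rhoper uK) => x.
  by rewrite eqrho mdv0.
have [lM lL] : 2 * M < lambda /\ K ^+ 2 / 2 + supnorm m0 * supnorm (derive1 f) < lambda.
  by apply/andP; rewrite -gt_max.
have mle := mfg_density_le _ _ f lambda K _ _ m0 u m l0 lM m0b fF uK mge sol.
set mu := supnorm m0 in mle lL m0b; set a := supnorm (derive1 f) in lL dfF.
have mu0 : 0 <= mu by apply: le_trans (m0b 0).
have a_ge0 : 0 <= a by apply: le_trans (dfF 0).
(* The loss K^2 / 2 comes from absorbing the drift in both equations. The second entry of [Lambda]
   says exactly [mu * a < L], which makes [c] positive. *)
pose L := lambda - K ^+ 2 / 2.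
have Lmua : mu * a < L by rewrite /L; lra.
have L0 : 0 < L by apply: le_lt_trans Lmua; exact: mulr_ge0.
pose c := L - (mu * a) ^+ 2 / L.
have c0 : 0 < c.
  rewrite subr_gt0 ltr_pdivrMr// -expr2 ltrXn2r// ?nnegrE ?(ltW L0)//.
  exact: mulr_ge0.
suff E x : c * rho x ^+ 2 = 0.
  by move=> x; apply/eqP; have /eqP := E x; rewrite mulf_eq0 gt_eqF//= sqrf_eq0.
move: x; apply: nonneg_le_div_eq0.
- apply: continuous_mul; first exact: cst_continuous.
  by apply: continuous_mul; exact: rho2.1.
- by move=> x; rewrite mulr_ge0 ?sqr_ge0 ?(ltW c0).
move=> eps eps0.
(* The weight 4 mu^2 bounds m^2, so the term m D rho . Dv splits into |D rho|^2 / 2 and a part of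
   the weighted |Dv|^2. *)
have [w [dw [wper wder dwc dwE]]] := divergence_pairing _ _ u m v rho rho v (4 * mu ^+ 2)
  u2 m2 v2 rho2 rho2 v2 uper mper vper rhoper rhoper vper.
exists w, dw; split=> // x; rewrite dwE laprhoE lapvE (gdotC _ _ u v).
have := gdot_square_ge0 _ _ rho u x (rho x).
have := gdot_square_ge0 _ _ rho v x (m x).
have := gdot_square_ge0 _ _ v u x (v x).
move: (uK x) (gdot_ge0 _ _ v x) (dfF (m x)) (mge x) (mle x).
move: (gdot u u x) (gdot rho rho x) (gdot v v x) (gdot rho u x) (gdot rho v x) (gdot v u x).
move: (rho x) (v x) (m x) (derive1 f (m x)) => r s n b U P Q X Y Z UK Q0 bF n0 nle S3 S2 S1.
have b2a2 : b ^+ 2 <= a ^+ 2 by rewrite -(real_normK (num_real b)) lerXn2r// nnegrE.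
have n2mu2 : n ^+ 2 <= 4 * mu ^+ 2.
  have -> : 4 * mu ^+ 2 = (2 * mu) ^+ 2 by ring.
  by rewrite lerXn2r// nnegrE mulr_ge0.
have LE : lambda = L + K ^+ 2 / 2 by rewrite /L subrK.
rewrite -subr_ge0 LE /c.
move: (gt_eqF L0) => /negbT; move: L0; move: (L) => l lpos lneq.
(* The difference is a sum of nonnegative terms: three completed gradient squares, the slack in |Du|
   <= K, m <= 2 mu and |f'| <= a, a square absorbing the product f'(m) rho v, and [eps]. *)
rewrite (_ : _ - _ = (P + 2 * r * X + r ^+ 2 * U) / 2 + (P + 2 * n * Y + n ^+ 2 * Q) / 2
  + 2 * mu ^+ 2 * (Q + 2 * s * Z + s ^+ 2 * U) + r ^+ 2 * (K ^+ 2 - U) / 2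
  + (4 * mu ^+ 2 - n ^+ 2) * Q / 2 + 2 * mu ^+ 2 * (s ^+ 2 * (K ^+ 2 - U))
  + 4 * mu ^+ 2 / l * ((l * s - b * r / 2) ^+ 2 + (a ^+ 2 - b ^+ 2) * r ^+ 2 / 4) + eps);
  last by field.
have KU : 0 <= K ^+ 2 - U by rewrite subr_ge0.
have mu2 : 0 <= mu ^+ 2 := sqr_ge0 mu.
have s2 : 0 <= s ^+ 2 := sqr_ge0 s.
have r2 : 0 <= r ^+ 2 := sqr_ge0 r.
have sq : 0 <= (l * s - b * r / 2) ^+ 2 := sqr_ge0 _.
have nn : 0 <= 4 * mu ^+ 2 - n ^+ 2 by rewrite subr_ge0.
have ab : 0 <= a ^+ 2 - b ^+ 2 by rewrite subr_ge0.
have [lge0 eps_ge0] := (ltW lpos, ltW eps0).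
by repeat first [assumption | apply: addr_ge0 | apply: divr_ge0 | apply: mulr_ge0 | exact: ler0n].
Qed.
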